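(* Suppose that $f^0,\dots,f^N$ and $\eta$ satisfy (H1)–(H5) as listed in the context, and that for all $t_0\in\mathbb R$ and $\varphi\in\mathcal C_{\mathbb K}$ the maximal solution of $$\dot x^{i}(t)=f^{i}(t,x^i(t),x^{i+1}(t))\ (0\le i\le N-1),\qquad \dot x^N(t)=f^N(t,x^N(t),x^0(\eta(t)))$$ with $x_{t_0}=\varphi$ is defined on $[t_0,\infty)$. If the process on $\mathcal C_{\mathbb K}$ generated by this system has a backwards-bounded global pullback attractor $\{\mathcal A(t)\}_{t\in\mathbb R}$, then $V(\varphi,-\tau(t))<\infty$ for all $t\in\mathbb R$ and all $\varphi\in\mathcal A(t)\setminus\{0\}$. Likewise, in the autonomous case (the $f^i$ do not depend on $t$ and $\tau$ is constant), if the semiflow on $\mathcal C_{\mathbb K}$ generated by the system has a global attractor $\mathcal A$, then $V(\varphi,-\tau)<\infty$ for all $\varphi\in\mathcal A\setminus\{0\}$.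
   Context: Fix an integer $N\ge 0$, a real $r>0$, and $\delta\in\{1,-1\}$. Functions $f^0,\dots,f^N:\mathbb R^3\to\mathbb R$, $(t,u,v)\mapsto f^i(t,u,v)$, and $\eta:\mathbb R\to\mathbb R$ are given; $D_j$ is the partial derivative with respect to the $j$-th argument; $\eta^k$ denotes the $k$-th iterate of $\eta$. For $N=0$ the system is the single equation $\dot x^0(t)=f^0(t,x^0(t),x^0(\eta(t)))$. (H1) Each $f^i$ is continuous in $t$ and $C^1$ in $(u,v)$, meaning that $f^i$, $D_2f^i$, $D_3f^i$ are continuous on $\mathbb R^3$. (H2) For all $t\in\mathbb R$ and $v\ne 0$: $v f^i(t,0,v)>0$ and $D_3f^i(t,0,0)>0$ for $0\le i\le N-1$; $\delta v f^N(t,0,v)>0$ and $\delta D_3f^N(t,0,0)>0$. (H3) $\eta$ is continuous and strictly increasing, and $\tau(t):=t-\eta(t)$ satisfies $0<\tau(t)\le r$ for all $t\in\mathbb R$. (H4) For any bounded set $B\subset\mathbb R^2$ there is a constant $C=C(B)>0$ such that $|f^i(t,u,v)|\le C(|u|+|v|)$ for all $0\le i\le N$, $t\in\mathbb R$ and $(u,v)\in B$. (H5) There is a constant $L>0$ such that all iterates $\eta^k$, $k\in\mathbb N$, are Lipschitz continuous with constant $L$. Phase space: $\mathbb K=[-r,0]\cup\{1,\dots,N\}$ and $\mathcal C_{\mathbb K}=C(\mathbb K,\mathbb R)$ with the sup norm. The segment $x_t\in\mathcal C_{\mathbb K}$ is $x_t(s)=x^0(t+s)$ for $s\in[-r,0]$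 and $x_t(s)=x^s(t)$ for $s\in\{1,\dots,N\}$. A solution on $[t_0,\omega)$ with initial function $\varphi$ at $t_0$ is $x=(x^0,\dots,x^N)$ with $x^0:[t_0-r,\omega)\to\mathbb R$ continuous on $[t_0-r,t_0]$ and $C^1$ on $[t_0,\omega)$, $x^i:[t_0,\omega)\to\mathbb R$ of class $C^1$ for $1\le i\le N$, satisfying the system for $t\in(t_0,\omega)$ and $x_{t_0}=\varphi$. Process: $S(t,t_0)\varphi=x_t$ for $t\ge t_0$, where $x$ is the unique solution with $x_{t_0}=\varphi$. The maps $S(t,s):\mathcal C_{\mathbb K}\to\mathcal C_{\mathbb K}$, $t\ge s$, satisfy $S(t,t)=\mathrm{id}$, $S(t,s)=S(t,t_1)S(t_1,s)$ for $t\ge t_1\ge s$, and $(t,s,\varphi)\mapsto S(t,s)\varphi$ is continuous. In the autonomous case the semiflow is $(t,\varphi)\mapsto S(t,0)\varphi$, $t\ge0$, and a global attractor is a compact set $\mathcal A\subset\mathcal C_{\mathbb K}$ with $S(t,0)\mathcal A=\mathcal A$ for all $t\ge0$ which attracts every bounded set. A family $\{\mathcal A(t)\}_{t\in\mathbb R}$ of subsets of $\mathcal C_{\mathbb K}$ is a global pullback attractor of $S$ if each $\mathcal A(t)$ is compact, $S(t,s)\mathcal A(s)=\mathcal A(t)$ for all $t\ge s$, and $\lim_{s\to-\infty}\mathrm{dist}(S(t,s)B,\mathcal A(t))=0$ for every $t\in\mathbb R$ and every bounded $B\subset\mathcal C_{\mathbb K}$, where $\mathrm{dist}$ is the Hausdorff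 semidistance. It is backwards-bounded if $\bigcup_{s\le t}\mathcal A(s)$ is bounded for all $t\in\mathbb R$. Sign changes: for $\varphi\in\mathcal C_{\mathbb K}\setminus\{0\}$ and $a\in[-r,0)$, $\mathrm{sc}(\varphi,a)\in\{0,1,2,\dots\}\cup\{\infty\}$ is the supremum of all integers $k\ge1$ for which there exist $\theta_k<\theta_{k-1}<\dots<\theta_0$ in $[a,0]\cup\{1,\dots,N\}$ with $\varphi(\theta_i)\varphi(\theta_{i-1})<0$ for $1\le i\le k$ (with $\sup\emptyset=0$). If $\delta=1$, $V(\varphi,a)$ equals $\mathrm{sc}(\varphi,a)$ if this is even or infinite, and $\mathrm{sc}(\varphi,a)+1$ if it is odd. If $\delta=-1$, $V(\varphi,a)$ equals $\mathrm{sc}(\varphi,a)$ if this is odd or infinite, and $\mathrm{sc}(\varphi,a)+1$ if it is even. *)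

(* Defs.v *)
From HB Require Import structures.
From mathcomp Require Import all_boot all_order all_algebra.
From mathcomp Require Import all_classical all_reals all_analysis.
Set Implicit Arguments.
Unset Strict Implicit.
Unset Printing Implicit Defensive.
Import Order.TTheory GRing.Theory Num.Theory.
Import numFieldNormedType.Exports.
Local Open Scope classical_set_scope.
Local Open Scope ring_scope.

(* [a, 0] together with the points 1, ..., N of the real line. *)
Definition history_set (R : realType) (a : R) (N : nat) : set R :=
  [set s | a <= s <= 0] `|` [set i%:R | i in [set i : nat | (0 < i <= N)%N]].

Definition K (R : realType) (r : R) (N : nat) : set R := history_set (- r) N.

(* C(K, R); K carries the subspace topology of R through set_type. *)
Definition CK (R : realType) (r : R) (N : nat) : Type :=
  continuousType (K r N) R.

Section CK_normed.
Context {R : realType} {r : R} {N : nat}.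
Local Notation E := (CK r N).
Implicit Types f g h : E.

HB.instance Definition _ := Choice.copy E (continuousType (K r N) R).

Lemma CK_eqP f g : f =1 g -> f = g.
Proof. by move=> fg; apply/continuousEP. Qed.

Let zero_cont : continuous (fun _ : K r N => 0 : R).
Proof. exact: cst_continuous. Qed.
Let add_cont f g : continuous (fun s : K r N => f s + g s : R).
Proof.
move=> x.
exact: (@continuousD R R (K r N) f g x (@cts_fun _ _ f x) (@cts_fun _ _ g x)).
Qed.
Let opp_cont f : continuous (fun s : K r N => - f s : R).
Proof.
by move=> x; exact: (@continuousN R R (K r N) f x (@cts_fun _ _ f x)).
Qed.
Let scale_cont (a : R) f : continuous (fun s : K r N => a * f s : R).
Proof.
move=> x; apply: (@continuousM R (K r N) (cst a) f x _ (@cts_fun _ _ f x)).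
exact: cst_continuous.
Qed.

Definition CK_zero : E := mkcts zero_cont.
Definition CK_add f g : E := mkcts (@add_cont f g).
Definition CK_opp f : E := mkcts (@opp_cont f).
Definition CK_scale (a : R) f : E := mkcts (@scale_cont a f).

Fact CK_addA : associative CK_add.
Proof. by move=> f g h; apply: CK_eqP => s; exact: addrA. Qed.
Fact CK_addC : commutative CK_add.
Proof. by move=> f g; apply: CK_eqP => s; exact: addrC. Qed.
Fact CK_add0 : left_id CK_zero CK_add.
Proof. by move=> f; apply: CK_eqP => s; exact: add0r. Qed.
Fact CK_addN : left_inverse CK_zero CK_opp CK_add.
Proof. by move=> f; apply: CK_eqP => s; exact: addNr. Qed.

HB.instance Definition _ :=
  GRing.isZmodule.Build E CK_addA CK_addC CK_add0 CK_addN.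

Fact CK_scaleA a b f : CK_scale a (CK_scale b f) = CK_scale (a * b) f.
Proof. by apply: CK_eqP => s; exact: mulrA. Qed.
Fact CK_scale1 : left_id 1 CK_scale.
Proof. by move=> f; apply: CK_eqP => s; exact: mul1r. Qed.
Fact CK_scaleDr : right_distributive CK_scale +%R.
Proof. by move=> a f g; apply: CK_eqP => s; exact: mulrDr. Qed.
Fact CK_scaleDl f : {morph CK_scale^~ f : a b / a + b}.
Proof. by move=> a b; apply: CK_eqP => s; exact: mulrDl. Qed.

HB.instance Definition _ :=
  GRing.Zmodule_isLmodule.Build R E CK_scaleA CK_scale1 CK_scaleDr CK_scaleDl.

Definition CK_norm f : R := sup [set `|f s| | s in [set: K r N]].

Lemma compact_K : compact (K r N).
Proof.
apply: compactU.
  have -> : [set s : R | - r <= s <= 0] = `[- r, 0]%classic.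
    by apply/seteqP; split=> s /=; rewrite in_itv.
  exact: segment_compact.
apply: finite_compact; apply: finite_image.
by apply: (@sub_finite_set _ _ `I_N.+1) => [i /= /andP[]|] //; exact: finite_II.
Qed.

Lemma CK_has_ubound f : has_ubound [set `|f s| | s in [set: K r N]].
Proof.
have fc := @cts_fun _ _ f.
have /subspace_valL_continuousP cf : continuous (f : K r N -> R) by exact: fc.
have /compact_bounded [M [_ /(_ (M + 1))]] := continuous_compact cf compact_K.
rewrite ltrDl ltr01 => /(_ isT) fM.
exists (M + 1) => _ [s _ <-]; apply: fM.
exists (set_val s); first exact: set_valP.
by rewrite -[in RHS](valLK point f).
Qed.

Lemma CK_norm_ub f s : `|f s| <= CK_norm f.
Proof. by apply: ub_le_sup; [exact: CK_has_ubound|exists s]. Qed.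

Lemma CK_norm_le f M : 0 <= M -> (forall s, `|f s| <= M) -> CK_norm f <= M.
Proof.
move=> M0 fM; rewrite /CK_norm; set A := (X in sup X).
have [->|/set0P A0] := eqVneq A set0; first by rewrite sup0.
by apply: ge_sup => // _ [s _ <-].
Qed.

Lemma CK_norm_ge0 f : 0 <= CK_norm f.
Proof.
rewrite /CK_norm; set A := (X in sup X).
have [->|/set0P [_ [s _ _]]] := eqVneq A set0; first by rewrite sup0.
exact: le_trans (normr_ge0 (f s)) (CK_norm_ub f s).
Qed.

Fact CK_normD f g : CK_norm (f + g) <= CK_norm f + CK_norm g.
Proof.
apply: CK_norm_le => [|s]; first by rewrite addr_ge0 ?CK_norm_ge0.
by apply: le_trans (ler_normD _ _) _; rewrite lerD ?CK_norm_ub.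
Qed.

Fact CK_normZ (a : R) f : CK_norm (a *: f) = `|a| * CK_norm f.
Proof.
have leZ b g : CK_norm (b *: g) <= `|b| * CK_norm g.
  apply: CK_norm_le => [|s]; first by rewrite mulr_ge0 ?CK_norm_ge0.
  by rewrite [_ s](_ : _ = b * g s)// normrM ler_wpM2l ?CK_norm_ub.
have [->|a0] := eqVneq a 0.
  apply/eqP; rewrite eq_le leZ normr0 mul0r; exact: CK_norm_ge0.
apply/eqP; rewrite eq_le leZ /= -ler_pdivlMl ?normr_gt0//.
by have := leZ a^-1 (a *: f); rewrite scalerA mulVf// scale1r normfV.
Qed.

Fact CK_norm0_eq0 f : CK_norm f = 0 -> f = 0.
Proof.
move=> f0; apply: CK_eqP => s.
by apply/normr0_eq0/eqP; rewrite -normr_le0 normr_id -f0 CK_norm_ub.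
Qed.

HB.instance Definition _ :=
  Lmodule_isNormed.Build R E CK_normD CK_normZ CK_norm0_eq0.

End CK_normed.

Section system.
Context {R : realType} (r : R) (N : nat).
Context (f : 'I_N.+1 -> R -> R -> R -> R) (eta : R -> R) (delta : R).

Definition D2 (g : R -> R -> R -> R) (t u v : R) : R :=
  derive1 (fun u' => g t u' v) u.

Definition D3 (g : R -> R -> R -> R) (t u v : R) : R :=
  derive1 (fun v' => g t u v') v.

Definition continuous3 (g : R -> R -> R -> R) : Prop :=
  continuous (fun p : R * R * R => g p.1.1 p.1.2 p.2).

Definition smooth_rhs : Prop := forall i,
  [/\ forall t u v, derivable (fun u' => f i t u' v) u 1,
      forall t u v, derivable (fun v' => f i t u v') v 1,
      continuous3 (f i), continuous3 (D2 (f i)) & continuous3 (D3 (f i))].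

Definition feedback_signs : Prop :=
  (forall i : 'I_N.+1, (i < N)%N -> forall t v, v != 0 ->
     0 < v * f i t 0 v /\ 0 < D3 (f i) t 0 0) /\
  (forall t v, v != 0 ->
     0 < delta * v * f ord_max t 0 v /\ 0 < delta * D3 (f ord_max) t 0 0).

Definition admissible_delay : Prop :=
  [/\ continuous eta, {homo eta : s t / s < t} &
      forall t, 0 < t - eta t <= r].

Definition linear_bound : Prop := forall B : set (R * R), bounded_set B ->
  exists2 C : R, 0 < C & forall i t (p : R * R), B p ->
    `|f i t p.1 p.2| <= C * (`|p.1| + `|p.2|).

Definition lipschitz_iterates : Prop :=
  exists2 L : R, 0 < L & forall k : nat, L.-lipschitz (iter k eta).

(* The last argument of the i-th equation: x^{i+1}(t) for i < N, and the
   delayed value x^0(eta(t)) for i = N. *)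
Definition feedback (x : 'I_N.+1 -> R -> R) (i : 'I_N.+1) (t : R) : R :=
  if (i < N)%N then x (inord i.+1) t else x ord0 (eta t).

(* x_t = phi *)
Definition is_segment (x : 'I_N.+1 -> R -> R) (t : R) (phi : CK r N) : Prop :=
  forall s : K r N,
    (set_val s <= 0 -> phi s = x ord0 (t + set_val s)) /\
    (forall i : 'I_N.+1, (0 < i)%N -> set_val s = i%:R -> phi s = x i t).

(* C^1 on an interval A, with one-sided derivatives at endpoints in A. *)
Definition C1_on (A : set R) (g : R -> R) : Prop :=
  exists2 dg : R -> R, {within A, continuous dg} &
    forall t, A t -> (g s - g t) / (s - t) @[s --> within A t^'] --> dg t.

Definition right_interval (t0 : R) (w : \bar R) : set R :=
  [set t | t0 <= t /\ (t%:E < w)%E].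

Definition is_solution (t0 : R) (w : \bar R) (phi : CK r N)
    (x : 'I_N.+1 -> R -> R) : Prop :=
  [/\ (t0%:E < w)%E,
      {within `[t0 - r, t0], continuous (x ord0)},
      forall i, C1_on (right_interval t0 w) (x i),
      forall i t, t0 < t -> (t%:E < w)%E ->
        is_derive t 1 (x i) (f i t (x i t) (feedback x i t)) &
      is_segment x t0 phi].

Definition is_maximal_solution (t0 : R) (w : \bar R) (phi : CK r N)
    (x : 'I_N.+1 -> R -> R) : Prop :=
  is_solution t0 w phi x /\
  forall (w' : \bar R) y, is_solution t0 w' phi y -> (w <= w')%E ->
    (forall i, {in right_interval t0 w, y i =1 x i}) -> w' = w.

Definition globally_solvable : Prop := forall (t0 : R) (phi : CK r N),
  exists x, is_maximal_solution t0 +oo%E phi x.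

(* S t s is meaningful only for s <= t.  Under smooth_rhs and admissible_delay
   solutions are unique, so S t s phi is then determined for s <= t. *)
Definition generated_process (S : R -> R -> CK r N -> CK r N) : Prop :=
  forall (t0 : R) (phi : CK r N),
    exists2 x, is_maximal_solution t0 +oo%E phi x &
      forall t, t0 <= t -> is_segment x t (S t t0 phi).

Definition autonomous (tau : R) : Prop :=
  (forall i t t' u v, f i t u v = f i t' u v) /\ (forall t, t - eta t = tau).

End system.

Section attractors.
Context {R : realType} {E : normedModType R}.

(* The value 0 is included so that the semidistance from the empty set is 0;
   it changes nothing if B is nonempty. *)
Definition semidist (B A : set E) : \bar R :=
  ereal_sup (0%E |` [set ereal_inf [set `|b - a|%:E | a in A] | b in B]).

Definition global_pullback_attractor (S : R -> R -> E -> E)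
    (A : R -> set E) : Prop :=
  [/\ forall t, compact (A t),
      forall s t, s <= t -> S t s @` A s = A t &
      forall t (B : set E), bounded_set B ->
        semidist (S t s @` B) (A t) @[s --> -oo%R] --> 0%E].

Definition backwards_bounded (A : R -> set E) : Prop :=
  forall t : R, bounded_set (\bigcup_(s in [set s | s <= t]) A s).

Definition global_attractor (T : R -> E -> E) (A : set E) : Prop :=
  [/\ compact A,
      forall t : R, 0 <= t -> T t @` A = A &
      forall B : set E, bounded_set B ->
        semidist (T t @` B) A @[t --> +oo%R] --> 0%E].

End attractors.

Section sign_changes.
Context {R : realType} {r : R} {N : nat}.

Definition alternates (phi : CK r N) (a : R) (k : nat) : Prop :=
  exists theta : nat -> K r N,
    [/\ forall i, (i <= k)%N -> history_set a N (set_val (theta i)),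
        forall i, (i < k)%N -> set_val (theta i.+1) < set_val (theta i) &
        forall i, (i < k)%N -> phi (theta i.+1) * phi (theta i) < 0].

(* 0 is adjoined to realize the convention sup set0 = 0. *)
Definition sc (phi : CK r N) (a : R) : \bar R :=
  ereal_sup (0%E |`
    [set k%:R%:E | k in [set k : nat | (0 < k)%N /\ alternates phi a k]]).

Definition V (delta : R) (phi : CK r N) (a : R) : \bar R :=
  let sc_parity b := exists k : nat, odd k = b /\ sc phi a = k%:R%:E in
  if delta == 1 then
    if `[< sc_parity true >] then (sc phi a + 1)%E else sc phi a
  else
    if `[< sc_parity false >] then (sc phi a + 1)%E else sc phi a.

End sign_changes.

(* Main.v *)
(* If V(phi) is infinite, the sign changes of phi on [-tau(t), 0] accumulate
   from one side at some point, i.e. x^0 is frequently positive and frequently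
   negative next to some z in [eta t, t].  The feedback conditions pass this
   property from x^i to x^{i+1}, and from x^N at z to x^0 at eta z, so all
   components of a solution through phi vanish at z, eta z, eta^2 z, ...
   Choose z0 = eta^m z <= t - r.  On [eta^k z0, eta^k t] the solution starts
   from 0 and is driven linearly by its values on [eta^{k+1} z0, eta^{k+1} t],
   which in an exponentially weighted norm gains a factor 3/4 per step.  Since
   bounded backward continuations exist on arbitrarily long intervals, phi = 0.
   Each continuation is used only on a finite interval, so no entire solution
   has to be glued together. *)
Require Import Defs.
From mathcomp Require Import all_boot all_order all_algebra.
From mathcomp Require Import all_classical all_reals all_analysis.
From mathcomp Require Import ring lra.
Set Implicit Arguments.
Unset Strict Implicit.
Unset Printing Implicit Defensive.
Import Order.TTheory GRing.Theory Num.Theory.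
Import numFieldNormedType.Exports.
Local Open Scope classical_set_scope.
Local Open Scope ring_scope.

(** * One-sided accumulation of sign changes *)

(** The sign [d] selects the side of [z], right for [1] and left for [-1], so that one inequality
    serves both. *)
Definition oscillates (R : realType) (d : R) (g : R -> R) (z : R) : Prop :=
  forall e, 0 < e ->
    (exists2 s, 0 < d * (s - z) < e & 0 < g s) /\
    (exists2 s, 0 < d * (s - z) < e & g s < 0).

(** The product form of the conclusion contradicts an alternation of signs directly. *)
Lemma not_oscillates (R : realType) (d : R) (g : R -> R) (z : R) :
  ~ oscillates d g z ->
  exists2 e, 0 < e & forall s s', 0 < d * (s - z) < e ->
    0 < d * (s' - z) < e -> 0 <= g s * g s'.
Proof.
move=> /existsNP[e] /not_implyP[e0] /not_andP H; exists e => // s s' hs hs'.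
case: H => H.
  have hle x : 0 < d * (x - z) < e -> g x <= 0.
    by move=> hx; rewrite leNgt; apply/negP => gx; apply: H; exists x.
  by rewrite mulr_le0 ?hle.
have hge x : 0 < d * (x - z) < e -> 0 <= g x.
  by move=> hx; rewrite leNgt; apply/negP => gx; apply: H; exists x.
by rewrite mulr_ge0 ?hge.
Qed.

(** Near a point without oscillation on either side, four points cannot alternate in sign. By
    compactness one radius [e] works on all of [[a, b]], so every three steps of an alternating
    sequence descend by at least [e], which bounds its length. *)
Lemma oscillation_point (R : realType) (g : R -> R) (a b : R) :
  (forall n, exists theta : nat -> R,
     [/\ forall i, (i <= n)%N -> a <= theta i <= b,
         forall i, (i < n)%N -> theta i.+1 < theta i &
         forall i, (i < n)%N -> g (theta i.+1) * g (theta i) < 0]) ->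
  exists z d, [/\ a <= z <= b, d = 1 \/ d = -1 & oscillates d g z].
Proof.
move=> alt; apply: contrapT => noosc.
pose window (e x : R) := exists th : nat -> R,
  [/\ forall i, (i <= 3)%N -> `|th i - x| < e,
      forall i, (i < 3)%N -> th i.+1 < th i &
      forall i, (i < 3)%N -> g (th i.+1) * g (th i) < 0].
have nowin : \forall e \near 0^'+, `[a, b] `<=` [set x | ~ window e x].
  have /compact_near_coveringP := @segment_compact R a b.
  apply => z /=; rewrite in_itv /= => zab.
  have [e1 e10 H1] : exists2 e, 0 < e & forall s s', 0 < 1 * (s - z) < e ->
      0 < 1 * (s' - z) < e -> 0 <= g s * g s'.
    by apply: not_oscillates => o; apply: noosc; exists z, 1; split; auto.
  have [e2 e20 H2] : exists2 e, 0 < e & forall s s', 0 < -1 * (s - z) < e ->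
      0 < -1 * (s' - z) < e -> 0 <= g s * g s'.
    by apply: not_oscillates => o; apply: noosc; exists z, (-1); split; auto.
  near=> x e => -[th [thx thd thg]].
  have xz1 : `|z - x| < e1 / 2.
    by near: x; apply: nbhsx_ballx; rewrite divr_gt0.
  have xz2 : `|z - x| < e2 / 2.
    by near: x; apply: nbhsx_ballx; rewrite divr_gt0.
  have ee1 : e < e1 / 2 by near: e; apply: nbhs_right_lt; rewrite divr_gt0.
  have ee2 : e < e2 / 2 by near: e; apply: nbhs_right_lt; rewrite divr_gt0.
  have thz1 i : (i <= 3)%N -> `|th i - z| < e1.
    move=> i3; rewrite (le_lt_trans (ler_distD x _ _))// [ltRHS]splitr.
    by rewrite ltrD ?(lt_trans (thx _ i3))// distrC.
  have thz2 i : (i <= 3)%N -> `|th i - z| < e2.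
    move=> i3; rewrite (le_lt_trans (ler_distD x _ _))// [ltRHS]splitr.
    by rewrite ltrD ?(lt_trans (thx _ i3))// distrC.
  have t01 := thd 0%N isT; have t12 := thd 1%N isT; have t23 := thd 2%N isT.
  (* Either [th 0] and [th 1] lie to the right of [z], or [th 2] and [th 3] lie to its left. *)
  have [z1|z1] := ltP z (th 1%N).
    have := thg 0%N isT; apply/negP; rewrite -leNgt; apply: H1.
      by have := thz1 1%N isT; rewrite ltr_norml => /andP[? ?]; lra.
    by have := thz1 0%N isT; rewrite ltr_norml => /andP[? ?]; lra.
  have := thg 2%N isT; apply/negP; rewrite -leNgt; apply: H2.
    by have := thz2 3%N isT; rewrite ltr_norml => /andP[? ?]; lra.
  by have := thz2 2%N isT; rewrite ltr_norml => /andP[? ?]; lra.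
have [e [e0 {}nowin]] := filter_ex (filterI (nbhs_right_gt 0) nowin).
have [m ltm] : exists m : nat, (b - a) / e < m%:R.
  exists (Num.truncn `|(b - a) / e|).+1.
  by rewrite (le_lt_trans (ler_norm _))// truncnS_gt.
have [th [thab thd thg]] := alt (3 * m)%N.
have mono i j : (i <= j)%N -> (j <= 3 * m)%N -> th j <= th i.
  elim: j => [|j IH]; first by rewrite leqn0 => /eqP ->.
  rewrite leq_eqVlt => /predU1P[->//|]; rewrite ltnS => ij jm.
  by rewrite (le_trans (ltW (thd _ jm)))// IH// ltnW.
have drop j : (j <= m)%N -> th (3 * j)%N <= th 0%N - j%:R * e.
  elim: j => [|j IH] jm; first by rewrite muln0 mul0r subr0.
  have j3 : (3 * j + 3 <= 3 * m)%N by rewrite -mulnSr leq_mul2l.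
  (* Otherwise four consecutive points would form a window around the first of them. *)
  have step : th (3 * j + 3)%N <= th (3 * j)%N - e.
    rewrite leNgt; apply/negP => stp.
    apply: (nowin (th (3 * j)%N)).
      by rewrite /= in_itv /= thab// (leq_trans _ j3)// leq_addr.
    exists (fun i => th (3 * j + i)%N); split => i i3.
    - have h1 := mono _ _ (leq_addr i (3 * j)%N)
        (leq_trans (leq_add (leqnn (3 * j)%N) i3) j3).
      have h2 := mono _ _ (leq_add (leqnn (3 * j)%N) i3) j3.
      by rewrite ler0_norm ?subr_le0//; lra.
    - by rewrite addnS thd// -addnS (leq_trans _ j3)// leq_add2l.
    - by rewrite addnS thg// -addnS (leq_trans _ j3)// leq_add2l.
  rewrite mulnSr (le_trans step)//.
  by have := IH (ltnW jm); rewrite -natr1 mulrDl mul1r; lra.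
have := drop m (leqnn m).
have := thab 0%N isT; have := thab (3 * m)%N (leqnn _).
by move: ltm; rewrite ltr_pdivrMr// => ltm /andP[? ?] /andP[? ?]; lra.
Unshelve. all: by end_near. Qed.

(** * Transfer of sign changes through a feedback equation *)

(** [C] bounds [D2 F] on a compact box; the mean value theorem then compares with [u = 0], where the
    feedback sign conditions apply. *)
Lemma locally_lipschitz_snd (R : realType) (F : R -> R -> R -> R) (a b M : R) :
  (forall t u v, derivable (fun u' => F t u' v) u 1) -> continuous3 (D2 F) ->
  exists2 C : R, 0 < C & forall t u v, a <= t <= b -> `|u| <= M -> `|v| <= M ->
    `|F t u v - F t 0 v| <= C * `|u|.
Proof.
move=> dF cF.
have /compact_bounded[C0 [_ CF]] : compact
    ((fun p : R * R * R => D2 F p.1.1 p.1.2 p.2) @`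
      (`[a, b] `*` `[- M, M] `*` `[- M, M])).
  apply: continuous_compact; first exact: continuous_subspaceT.
  by do !apply: compact_setX; exact: segment_compact.
have [C Cgt0 {CF}CF] : exists2 C : R, 0 < C & forall t u v, a <= t <= b ->
    `|u| <= M -> `|v| <= M -> `|D2 F t u v| <= C.
  exists (`|C0| + 1); first by rewrite ltr_wpDl.
  move=> t u v tab uM vM; apply: CF; first by rewrite ltr_pwDr ?ler_norm.
  by exists (t, u, v) => //=; rewrite !in_itv /= tab -!ler_norml.
exists C => // t u v tab uM vM.
have M0 : 0 <= M := le_trans (normr_ge0 _) uM.
have mvt (c d : R) : c <= d -> `|c| <= M -> `|d| <= M ->
    `|F t d v - F t c v| <= C * (d - c).
  move=> cd cM dM.
  have is_D (x : R) : is_derive x (1 : R) (fun u' => F t u' v) (D2 F t x v).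
    by rewrite /D2 derive1E; exact: derivableP.
  have cF1 : {within `[c, d], continuous (fun u' => F t u' v)}.
    by apply: derivable_within_continuous => x _; exact: dF.
  have [x xcd ->] := MVT_segment cd (fun x _ => is_D x) cF1.
  rewrite normrM (@ger0_norm _ (d - c)) ?subr_ge0//.
  rewrite ler_wpM2r ?subr_ge0// CF//.
  move: xcd cM dM; rewrite in_itv /= !ler_norml.
  by move=> /andP[? ?] /andP[? ?] /andP[? ?]; lra.
have [u0|u0] := leP 0 u.
  have := mvt 0 u u0; rewrite subr0 normr0 => /(_ M0 uM).
  by rewrite (ger0_norm u0).
have := mvt u 0 (ltW u0); rewrite sub0r distrC normr0 => /(_ uM M0).
by rewrite -(ltr0_norm u0).
Qed.

(* If [v] had the wrong sign throughout, then after its last zero [u] would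
   satisfy [w' <= C w] for [w = |u|], so it could not leave 0. *)
Lemma sign_transition (R : realType) (F : R -> R -> R -> R) (u v : R -> R)
    (d a b : R) :
  (forall t u v, derivable (fun u' => F t u' v) u 1) -> continuous3 (D2 F) ->
  (forall t, F t 0 0 = 0) ->
  (forall t w, w != 0 -> 0 < d * w * F t 0 w) ->
  a < b ->
  (forall s, a <= s <= b -> is_derive s 1 u (F s (u s) (v s))) ->
  {within `[a, b], continuous v} ->
  u a * u b < 0 ->
  exists2 s, a <= s <= b & 0 < d * v s * u b.
Proof.
move=> dF cF F00 sF ab du cv uab; apply: contrapT => nos.
have {}nos s : a <= s <= b -> d * v s * u b <= 0.
  by move=> sab; rewrite leNgt; apply/negP => h; apply: nos; exists s.
have cu : {within `[a, b], continuous u}.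
  apply: derivable_within_continuous => s; rewrite in_itv /= => /du.
  by case.
have [M uvM] : exists M, forall s, a <= s <= b -> `|u s| <= M /\ `|v s| <= M.
  have cab := @segment_compact R a b.
  have /compact_bounded[M1 [_ uM]] := continuous_compact cu cab.
  have /compact_bounded[M2 [_ vM]] := continuous_compact cv cab.
  exists (`|M1| + `|M2| + 1) => s sab; split.
    apply: uM; last by exists s => //=; rewrite in_itv.
    by rewrite ltr_pwDr// (le_trans (ler_norm _))// lerDl.
  apply: vM; last by exists s => //=; rewrite in_itv.
  by rewrite ltr_pwDr// (le_trans (ler_norm _))// lerDr.
have [C C0 FC] := locally_lipschitz_snd a b M dF cF.
(* [k] is the sign of [u b], so [w = k * u] is negative at [a] and positive at [b]. *)
have [k k1 kub] : exists2 k : R, k * k = 1 & 0 < k * u b.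
  have [ub|ub|ub] := ltgtP 0 (u b).
  - by exists 1; rewrite ?mulr1 ?mul1r.
  - by exists (-1); rewrite ?mulrNN ?mulr1// mulN1r oppr_gt0.
  - by move: uab; rewrite -ub mulr0 ltxx.
have kua : k * u a < 0.
  have : (k * u a) * (k * u b) < 0 by rewrite mulrACA k1 mul1r.
  by rewrite pmulr_llt0.
pose w s := k * u s.
pose A := [set s | a <= s <= b /\ w s <= 0].
have Aa : A a by split; [rewrite lexx ltW|rewrite /w ltW].
have hsA : has_sup A by split; [exists a|exists b => s -[/andP[]]].
(* This is the last point of [[a, b]] with [w <= 0]; the differential inequality is used to its
   right. *)
pose z := sup A.
have az : a <= z by apply: ub_le_sup; [case: hsA|].
have zb : z <= b by apply: ge_sup; [exists a|move=> s -[/andP[]]].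
have wpos s : z < s <= b -> 0 < w s.
  move=> /andP[zs sb]; rewrite ltNge; apply/negP => ws.
  have : s <= z; last by rewrite leNgt zs.
  by apply: ub_le_sup; [case: hsA|split; rewrite ?sb ?(le_trans az)// ltW].
have wz : w z <= 0.
  rewrite leNgt; apply/negP => wz0.
  have uz : is_derive z 1 u (F z (u z) (v z)) by apply: du; rewrite az.
  have cwz : w s @[s --> z] --> w z.
    apply: cvgMr; apply: differentiable_continuous.
    by apply/derivable1_diffP; case: uz.
  move: cwz => /cvgrPdist_lt/(_ _ wz0)/nbhs_ballP[e /= e0 he].
  have [s [/andP[as_ sb] ws] zs] := sup_adherent e0 hsA.
  have sz : s <= z by apply: ub_le_sup; [case: hsA|split; rewrite ?as_].
  have /he : ball z e s.
    by rewrite /ball /= ger0_norm ?subr_ge0//; rewrite -/z in zs; lra.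
  by rewrite /= ltr_norml => /andP[_]; lra.
have zltb : z < b.
  rewrite lt_neqAle zb andbT; apply/eqP => zb'.
  by move: wz; rewrite zb' leNgt kub.
(* The weight absorbs the growth rate: [w' <= C * w] gives [psi' <= 0], against
   [psi z <= 0 < psi b]. *)
pose psi s := w s * expR (- C * s).
pose dpsi s := w s * (- C * expR (- C * s)) +
  expR (- C * s) * (k * F s (u s) (v s)).
have is_dpsi s : a <= s <= b -> is_derive s 1 psi (dpsi s).
  move=> sab; have := du s sab => dus.
  have dws : is_derive s 1 w (k * F s (u s) (v s)).
    exact: is_deriveZ.
  have dex : is_derive s 1 (fun x : R => expR (- C * x)) (- C * expR (- C * s)).
    have dCx : is_derive s 1 (fun x : R => - C * x) (- C).
      rewrite -[X in is_derive _ _ _ X](mulr1 (- C)).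
      exact: (is_deriveZ (- C) (is_derive_id s 1)).
    by rewrite mulrC; exact: (is_derive1_comp (is_derive_expR _) dCx).
  exact: is_deriveM.
have zbab s : z <= s <= b -> a <= s <= b.
  by move=> /andP[zs ->]; rewrite (le_trans az).
have dpsi_zb s : s \in `]z, b[ -> is_derive s 1 psi (dpsi s).
  by rewrite in_itv /= => /andP[zs sb]; apply/is_dpsi/zbab; rewrite !ltW.
have cpsi : {within `[z, b], continuous psi}.
  apply: derivable_within_continuous => s; rewrite in_itv /= => /zbab.
  by move=> /is_dpsi; case.
have [c + E] := MVT zltb dpsi_zb cpsi.
rewrite in_itv /= => /andP[zc cb].
have cab : a <= c <= b by rewrite (le_trans az) ?ltW.
have wc : 0 < w c by apply: wpos; rewrite zc ltW.
have key : k * F c (u c) (v c) <= C * w c.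
  have [uM vM] := uvM c cab.
  have := FC c (u c) (v c) cab uM vM.
  have -> : `|u c| = w c.
    rewrite -(gtr0_norm wc) /w normrM.
    suff -> : `|k| = 1 by rewrite mul1r.
    by apply/eqP; rewrite -sqrp_eq1// -normrX expr2 k1 normr1.
  have kk : k = 1 \/ k = -1.
    by move/eqP: k1; rewrite -expr2 sqrf_eq1 => /orP[]/eqP; auto.
  (* By [nos], the feedback at [u = 0] does not push towards the sign of [u b]. *)
  have kF : k * F c 0 (v c) <= 0.
    have [->|v0] := eqVneq (v c) 0; first by rewrite F00 mulr0.
    have := sF c _ v0; have := nos _ cab; move: kub.
    by case: kk => ->; rewrite ?mul1r ?mulN1r => kub; nra.
  rewrite ler_norml => /andP[].
  by case: kk kF => ->; lra.
have : psi b - psi z <= 0.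
  rewrite E pmulr_lle0 ?subr_gt0// /dpsi.
  have := expR_gt0 (- C * c); move: (expR _) => ex ex0.
  have -> : w c * (- C * ex) + ex * (k * F c (u c) (v c)) =
     ex * (k * F c (u c) (v c) - C * w c) by rewrite mulrBr; lra.
  by rewrite pmulr_rle0// subr_le0.
apply/negP; rewrite -ltNge subr_gt0 (@le_lt_trans _ _ 0)//.
  by rewrite /psi pmulr_lle0 ?expR_gt0.
by rewrite /psi pmulr_lgt0 ?expR_gt0.
Qed.

(** Three points near [z] where [u] is positive, negative, positive give two transitions of [u] with
    opposite final signs; [sign_transition] turns each into a point where [c * v] has that final
    sign. *)
Lemma oscillates_feedback (R : realType) (F : R -> R -> R -> R)
    (u v : R -> R) (c d z : R) :
  (forall t u v, derivable (fun u' => F t u' v) u 1) -> continuous3 (D2 F) ->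
  (forall t, F t 0 0 = 0) ->
  (forall t w, w != 0 -> 0 < c * w * F t 0 w) ->
  c = 1 \/ c = -1 -> d = 1 \/ d = -1 ->
  (\forall s \near z, is_derive s (1 : R) u (F s (u s) (v s))) ->
  (\forall s \near z, {for s, continuous v}) ->
  oscillates d u z -> oscillates d v z.
Proof.
move=> dF cF F00 sF c1 d1 du cv osc e e0.
have [e1 /= e10 near_z] := (nbhs_ballP _ _).1 (filterI du cv).
pose e' := Num.min e e1.
have e'0 : 0 < e' by rewrite lt_min e0.
have tr a b : a < b -> 0 < d * (a - z) < e' -> 0 < d * (b - z) < e' ->
    u a * u b < 0 -> exists2 s, 0 < d * (s - z) < e' & 0 < c * v s * u b.
  move=> ab az bz uab.
  have side s : a <= s <= b -> 0 < d * (s - z) < e'.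
    by move: az bz; case: d1 => ->;
      move=> /andP[? ?] /andP[? ?] /andP[? ?]; apply/andP; split; lra.
  have inball s : a <= s <= b -> ball z e1 s.
    move=> /side; rewrite lt_min /ball /= distrC => /and3P[h0 _].
    suff -> : `|s - z| = d * (s - z) by [].
    case: d1 h0 => ->; rewrite ?mul1r ?mulN1r => h0.
      by rewrite gtr0_norm.
    by rewrite ltr0_norm// -oppr_gt0.
  have duab s : a <= s <= b -> is_derive s (1 : R) u (F s (u s) (v s)).
    by move=> /inball h; exact: (near_z _ h).1.
  have cvab : {within `[a, b], continuous v}.
    apply: continuous_in_subspaceT => s; rewrite inE /= in_itv /=.
    by move=> /inball h; exact: (near_z _ h).2.
  have [s /side sab hs] := sign_transition dF cF F00 sF ab duab cvab uab.
  by exists s.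
(* Each point is chosen closer to [z] than the one before, so the three are ordered. *)
have [[s1 h1 u1] _] := osc e' e'0.
have [_ [s2 h2 u2]] := osc _ (andP h1).1.
have [[s3 h3 u3] _] := osc _ (andP h2).1.
have h2' : 0 < d * (s2 - z) < e'.
  by move: h2 h1 => /andP[-> /lt_trans h] /andP[_ /h].
have h3' : 0 < d * (s3 - z) < e'.
  by move: h3 h2' => /andP[-> /lt_trans h] /andP[_ /h].
have [neg pos] : (exists2 s, 0 < d * (s - z) < e' & c * v s < 0) /\
    (exists2 s, 0 < d * (s - z) < e' & 0 < c * v s).
  case: d1 => d1; rewrite {}d1 in h1 h2 h3 h2' h3' tr *.
  - have s32 : s3 < s2 by lra.
    have s21 : s2 < s1 by lra.
    have u32 : u s3 * u s2 < 0 by rewrite nmulr_llt0.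
    have u21 : u s2 * u s1 < 0 by rewrite nmulr_rlt0.
    have [s hs vs] := tr s3 s2 s32 h3' h2' u32.
    have [s' hs' vs'] := tr s2 s1 s21 h2' h1 u21.
    by split; [exists s => //; rewrite -(nmulr_lgt0 _ u2)|
      exists s' => //; rewrite -(pmulr_lgt0 _ u1)].
  - have s12 : s1 < s2 by lra.
    have s23 : s2 < s3 by lra.
    have u12 : u s1 * u s2 < 0 by rewrite nmulr_llt0.
    have u23 : u s2 * u s3 < 0 by rewrite nmulr_rlt0.
    have [s hs vs] := tr s1 s2 s12 h1 h2' u12.
    have [s' hs' vs'] := tr s2 s3 s23 h2' h3' u23.
    by split; [exists s => //; rewrite -(nmulr_lgt0 _ u2)|
      exists s' => //; rewrite -(pmulr_lgt0 _ u3)].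
have le_e s : 0 < d * (s - z) < e' -> 0 < d * (s - z) < e.
  by rewrite lt_min => /and3P[-> ->].
move: neg pos => [s /le_e hs vs] [s' /le_e hs' vs'].
case: c1 => c1; rewrite c1 ?mul1r ?mulN1r ?oppr_gt0 ?oppr_lt0 in vs vs'.
  by split; [exists s'|exists s].
by split; [exists s|exists s'].
Qed.

(** Monotonicity of [h] preserves the side and continuity the closeness; this is used for
    [h = eta]. *)
Lemma oscillates_comp (R : realType) (g h : R -> R) (d z : R) :
  d = 1 \/ d = -1 -> {homo h : s t / s < t} -> {for z, continuous h} ->
  oscillates d (g \o h) z -> oscillates d g (h z).
Proof.
move=> d1 hh ch osc e e0.
have /cvgrPdist_lt/(_ _ e0)/nbhs_ballP[e1 /= e10 hz] := ch.
have side s : 0 < d * (s - z) < e1 -> 0 < d * (h s - h z) < e.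
  case: d1 => ->; rewrite ?mul1r ?mulN1r ?opprB ?subr_gt0 => /andP[sz se].
    have /hz : ball z e1 s by rewrite /ball /= ltr0_norm ?opprB// subr_lt0.
    by rewrite hh//= ltr0_norm ?opprB// subr_lt0 hh.
  have /hz : ball z e1 s by rewrite /ball /= gtr0_norm// subr_gt0.
  by rewrite hh//= gtr0_norm// subr_gt0 hh.
have [[s hs gs] [s' hs' gs']] := osc _ e10.
by split; [exists (h s)|exists (h s')] => //; exact: side.
Qed.

Lemma oscillates_zero (R : realType) (g : R -> R) (d z : R) :
  d = 1 \/ d = -1 -> {for z, continuous g} -> oscillates d g z -> g z = 0.
Proof.
move=> d1 cg osc; apply/eqP; apply: contraT => gz.
have gz0 : 0 < `|g z| by rewrite normr_gt0.
have /cvgrPdist_lt/(_ _ gz0)/nbhs_ballP[e /= e0 hz] := cg.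
have inball s : 0 < d * (s - z) < e -> ball z e s.
  rewrite /ball /= distrC => /andP[h0].
  case: d1 h0 => ->; rewrite ?mul1r ?mulN1r => h0; first by rewrite gtr0_norm.
  by rewrite ltr0_norm// -oppr_gt0.
have [[s /inball/hz hs gs] [s' /inball/hz hs' gs']] := osc _ e0.
move: hs hs' => /=; have [g0|g0|g0] := ltgtP (g z) 0.
- by rewrite (ltr0_norm g0) !ltr_norml => /andP[? ?] /andP[? ?]; lra.
- by rewrite (gtr0_norm g0) !ltr_norml => /andP[? ?] /andP[? ?]; lra.
- by rewrite g0 eqxx in gz.
Qed.

(** * Iterates of [eta], and decay and oscillation along the history of a solution *)

Lemma linear_bound_zero (R : realType) (N : nat)
    (f : 'I_N.+1 -> R -> R -> R -> R) :
  linear_bound f -> forall i t, f i t 0 0 = 0.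
Proof.
have b0 : bounded_set [set ((0, 0) : R * R)].
  by apply: compact_bounded; exact: compact_set1.
move=> /(_ _ b0) [C C0 fC] i t.
apply/eqP; rewrite -normr_le0.
by have := fC i t (0, 0) erefl; rewrite /= normr0 addr0 mulr0.
Qed.

Lemma iter_eta_lt (R : realType) (r : R) (eta : R -> R) (k : nat) :
  admissible_delay r eta -> {homo iter k eta : s t / s < t}.
Proof. by move=> [_ inc _]; elim: k => //= k IH s t st; exact/inc/IH. Qed.

Lemma iter_eta_le (R : realType) (r : R) (eta : R -> R) (k : nat) :
  admissible_delay r eta -> {homo iter k eta : s t / s <= t}.
Proof.
move=> He s t; rewrite le_eqVlt => /predU1P[->//|st].
by rewrite ltW// (iter_eta_lt _ He).
Qed.

Lemma iter_eta_le_id (R : realType) (r : R) (eta : R -> R) (k : nat) (s : R) :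
  admissible_delay r eta -> iter k eta s <= s.
Proof.
move=> [_ _ tau]; elim: k => //= k IH; apply: le_trans IH.
by have /andP[h _] := tau (iter k eta s); rewrite -subr_ge0 ltW.
Qed.

Lemma iter_eta_cont (R : realType) (r : R) (eta : R -> R) (k : nat) :
  admissible_delay r eta -> continuous (iter k eta).
Proof.
move=> [ce _ _]; elim: k => [|k IH] x; first exact: cvg_id.
exact: (@continuous_comp _ _ _ (iter k eta) eta x (IH x) (ce _)).
Qed.

(* Weighting by [expR (lam * (s - z0))] makes the integral operator behind the
   k-th step a contraction with factor 3/4, uniformly in k because the
   iterates of [eta] share the Lipschitz constant [L]. *)
Lemma history_decay (R : realType) (N : nat) (r : R)
    (f : 'I_N.+1 -> R -> R -> R -> R) (eta : R -> R) (x : 'I_N.+1 -> R -> R)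
    (s0 z0 t M C L : R) (K : nat) :
  admissible_delay r eta -> 0 < C -> 0 < L ->
  (forall k, L.-lipschitz (iter k eta)) ->
  (forall i s u v, `|u| <= M -> `|v| <= M ->
     `|f i s u v| <= C * (`|u| + `|v|)) ->
  (forall i s, s0 < s ->
     is_derive s 1 (x i) (f i s (x i s) (feedback eta x i s))) ->
  (forall i s, s0 <= s <= t -> `|x i s| <= M) ->
  (forall k, (k <= K)%N -> s0 < iter k eta z0) ->
  (forall k i, (k <= K)%N -> x i (iter k eta z0) = 0) ->
  forall n k, (k + n <= K)%N -> forall i s, z0 <= s <= t ->
    `|x i (iter k eta s)| <= M * (3 / 4) ^+ n * expR (8 * L * C * (s - z0)).
Proof.
move=> He C0 L0 lipL fC dx xM s0z x0.
pose E s := expR (8 * L * C * (s - z0)).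
have lam0 : 0 < 8 * L * C by rewrite !mulr_gt0.
have Emono s s' : s <= s' -> E s <= E s'.
  by move=> ss'; rewrite ler_expR ler_wpM2l ?(ltW lam0)// lerD2r.
have bounds k s : (k <= K)%N -> z0 <= s <= t -> s0 < iter k eta s <= t.
  move=> kK /andP[zs st]; rewrite (lt_le_trans (s0z k kK)).
    by rewrite (le_trans (iter_eta_le_id _ _ He)).
  exact: (iter_eta_le _ He).
have xMk k s i : (k <= K)%N -> z0 <= s <= t -> `|x i (iter k eta s)| <= M.
  by move=> kK /(bounds k _ kK)/andP[h1 h2]; apply: xM; rewrite ltW.
(* The induction treats all [k] at once: the delayed term at level [k] lives at level [k.+1], so
   [k + n] is what stays bounded by [K]. *)
elim=> [|n IH] k knK i s /andP[zs st].
  have kK : (k <= K)%N by rewrite addn0 in knK.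
  rewrite expr0 mulr1; have h := xMk k s i kK; rewrite zs in h.
  rewrite (le_trans (h st))// ler_peMr ?(le_trans _ (h st))//.
  rewrite (le_trans _ (expR_ge1Dx _))// lerDl.
  by rewrite mulr_ge0 ?(ltW lam0)// subr_ge0.
have kK : (k < K)%N by apply: leq_trans knK; rewrite addnS ltnS leq_addr.
set m := M * (3 / 4) ^+ n in IH.
(* The comparison point lies at most one time constant of the weight before [s], and never before
   [z0]. *)
pose q := Num.max z0 (s - (8 * L * C)^-1).
have zq : z0 <= q by rewrite le_max lexx.
have qs : q <= s by rewrite ge_max zs gerBl invr_ge0 ltW.
have qst : z0 <= q <= t by rewrite zq (le_trans qs).
(* Read off from the bound itself, which dominates an absolute value. *)
have m0 : 0 <= m.
  have h : `|x i (iter k eta s)| <= m * E s.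
    by apply: IH; rewrite ?zs// ltnW// -addnS.
  by have := le_trans (normr_ge0 _) h; rewrite pmulr_lge0// expR_gt0.
have ab : iter k eta q <= iter k eta s by exact: (iter_eta_le _ He).
(* Writing [y = iter k eta p] with [p] in [[q, s]], the delayed time is [iter k.+1 eta p], so the
   induction hypothesis covers both arguments of [f]. *)
have db y : iter k eta q <= y <= iter k eta s ->
    `|f i y (x i y) (feedback eta x i y)| <= 2 * C * m * E s.
  move=> yab.
  have [p] : exists2 p, p \in `[q, s] & iter k eta p = y.
    apply: IVT => //.
      by apply: continuous_subspaceT; exact: (iter_eta_cont He).
    by rewrite (min_idPl ab) (max_idPr ab).
  rewrite in_itv /= => /andP[qp ps] py.
  have zpt : z0 <= p <= t by rewrite (le_trans zq)// (le_trans ps).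
  have hx j : `|x j y| <= m * E s.
    rewrite -py (le_trans (IH k _ j p zpt))//; first by rewrite ltnW// -addnS.
    by rewrite ler_wpM2l// Emono.
  have hfb : `|feedback eta x i y| <= m * E s /\ `|feedback eta x i y| <= M.
    rewrite /feedback; case: ifP => _.
      by split=> //; rewrite -py; apply: xMk => //; exact: ltnW.
    rewrite -py -iterS; split; last by apply: xMk.
    rewrite (le_trans (IH k.+1 _ ord0 p zpt))//; first by rewrite addSnnS.
    by rewrite ler_wpM2l// Emono.
  apply: (le_trans (fC _ _ _ _ _ hfb.2)).
    by rewrite -py; apply: xMk => //; exact: ltnW.
  have -> : 2 * C * m * E s = C * (m * E s + m * E s) by lra.
  by rewrite ler_wpM2l ?(ltW C0)//; apply: lerD; [exact: hx|exact: hfb.1].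
have der y : y \in `]iter k eta q, iter k eta s[ ->
    is_derive y 1 (x i) (f i y (x i y) (feedback eta x i y)).
  rewrite in_itv /= => /andP[qy _]; apply: dx.
  by rewrite (lt_trans _ qy)//; have /andP[] := bounds k q (ltnW kK) qst.
have cx : {within `[iter k eta q, iter k eta s], continuous (x i)}.
  apply: derivable_within_continuous => y; rewrite in_itv /= => /andP[qy _].
  have /dx : s0 < y; last by move=> /(_ i) [].
  by rewrite (lt_le_trans _ qy)//; have /andP[] := bounds k q (ltnW kK) qst.
have [y] := MVT_segment ab der cx; rewrite in_itv /= => yab inc.
(* A slope of at most [2 * C * m * E s] over a length of at most [1 / (8 * C)] gives the quarter. *)
have step : `|x i (iter k eta s) - x i (iter k eta q)| <= 4^-1 * m * E s.
  rewrite inc normrM.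
  have lip : `|iter k eta s - iter k eta q| <= (8 * C)^-1.
    have := lipL k (s, q) (conj I I); rewrite /= => /le_trans; apply.
    rewrite ger0_norm ?subr_ge0//.
    have : s - q <= (8 * L * C)^-1 by rewrite lerBlDl -lerBlDr le_max lexx orbT.
    move=> /(ler_wpM2l (ltW L0)) /le_trans; apply.
    have -> // : L * (8 * L * C)^-1 = (8 * C)^-1.
    by field; rewrite !gt_eqF.
  apply: (le_trans (ler_pM _ _ (db y yab) lip)) => //.
  have -> // : 2 * C * m * E s * (8 * C)^-1 = 4^-1 * m * E s.
  by field; rewrite gt_eqF.
(* Either [q = z0], where the solution vanishes, or going back one time constant gains
   [exp(-1) <= 1/2]. The factor [3/4] is [1/4 + 1/2]. *)
have start : `|x i (iter k eta q)| <= 2^-1 * m * E s.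
  have [qz|qz] := leP (s - (8 * L * C)^-1) z0.
    rewrite /q (max_idPl qz) x0 ?(ltnW kK)// normr0.
    by rewrite mulr_ge0 ?expR_ge0// mulr_ge0// invr_ge0.
  have {}IH := IH k _ i q qst.
  have /IH /le_trans : (k + n <= K)%N by rewrite ltnW// -addnS.
  have -> : 2^-1 * m * E s = m * (2^-1 * E s) by lra.
  apply; rewrite ler_wpM2l// /E.
  rewrite /q (max_idPr (ltW qz)).
  have -> : 8 * L * C * (s - (8 * L * C)^-1 - z0) = 8 * L * C * (s - z0) - 1.
    by field; rewrite !gt_eqF.
  rewrite expRD mulrC ler_wpM2r ?expR_ge0// expRN lef_pV2 ?posrE ?expR_gt0//.
  by have := @expR_ge1Dx R 1; lra.
rewrite -(subrK (x i (iter k eta q)) (x i (iter k eta s))).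
rewrite (le_trans (ler_normD _ _))// (le_trans (lerD step start))//.
have -> : M * (3 / 4) ^+ n.+1 = m * (3 / 4) by rewrite exprSr [LHS]mulrA.
rewrite -/(E s) -mulrDl ler_wpM2r ?expR_ge0//.
by clearbody m; lra.
Qed.

(** One turn of the feedback loop: each equation hands the oscillation at [z] to the next component,
    and the last one hands it to [x ord0 \o eta]. The bound [s0 < eta z] keeps the delayed argument
    inside the solution interval near [z]. *)
Lemma history_oscillates (R : realType) (N : nat) (r delta : R)
    (f : 'I_N.+1 -> R -> R -> R -> R) (eta : R -> R) (x : 'I_N.+1 -> R -> R)
    (s0 d z : R) :
  delta = 1 \/ delta = -1 -> smooth_rhs f -> feedback_signs f delta ->
  admissible_delay r eta -> linear_bound f ->
  (forall i s, s0 < s ->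
     is_derive s 1 (x i) (f i s (x i s) (feedback eta x i s))) ->
  d = 1 \/ d = -1 -> s0 < eta z -> oscillates d (x ord0) z ->
  (forall i, oscillates d (x i) z) /\ oscillates d (x ord0) (eta z).
Proof.
move=> delta1 H1 [signs signN] He H4 dx d1 s0z osc0.
have [ceta inc tau] := He.
have eta_lt s : eta s < s by have /andP[] := tau s; rewrite subr_gt0.
have cx i s : s0 < s -> {for s, continuous (x i)}.
  move=> s0s; have [dxs _] := dx i s s0s.
  by apply: differentiable_continuous; apply/derivable1_diffP.
have near_z : \forall s \near z, s0 < eta s.
  exact: (cvgr_gt _ (ceta z) _ s0z).
have near_z' : \forall s \near z, s0 < s.
  by apply: filterS near_z => s /lt_trans; apply.
have fbE i : feedback eta x i =
    if (i < N)%N then x (inord i.+1) else x ord0 \o eta.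
  by apply/funext => s; rewrite /feedback; case: ifP.
have cfb i : \forall s \near z, {for s, continuous (feedback eta x i)}.
  rewrite fbE; case: (i < N)%N.
    by apply: filterS near_z' => s; exact: cx.
  apply: filterS near_z => s s0s.
  by apply: (@continuous_comp _ _ _ eta (x ord0)); [exact: ceta|exact: cx].
have step i : oscillates d (x i) z -> oscillates d (feedback eta x i) z.
  have [dF _ _ cF _] := H1 i.
  pose c : R := if (i < N)%N then 1 else delta.
  apply: (@oscillates_feedback _ (f i) _ _ c) => //.
  - by move=> s; exact: linear_bound_zero.
  - move=> s w w0; rewrite /c; case: ifPn => iN.
      by rewrite mul1r; case: (signs i iN s w w0).
    have -> : i = ord_max.
      by apply/val_inj/eqP; rewrite /= eqn_leq -ltnS ltn_ord leqNgt.
    by case: (signN s w w0).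
  - by rewrite /c; case: ifP => _; auto.
  - by apply: filterS near_z' => s; exact: dx.
have osc i : oscillates d (x i) z.
  case: i => i; elim: i => [|i IH] iN.
    by rewrite (_ : Ordinal iN = ord0)//; exact: val_inj.
  have := step _ (IH (ltnW iN)); rewrite fbE /= -ltnS iN.
  by rewrite (_ : inord i.+1 = Ordinal iN)//; apply: val_inj; rewrite /= inordK.
split=> //; apply: oscillates_comp => //; first exact: ceta.
by have := step _ (osc ord_max); rewrite fbE /= ltnn.
Qed.

(** If the iterates stayed in [[y, z]], the positive continuous delay would have a positive minimum
    there, and each iteration would descend by at least that much. *)
Lemma iter_eta_unbounded (R : realType) (r : R) (eta : R -> R) (z y : R) :
  admissible_delay r eta -> exists m, iter m eta z < y.
Proof.
move=> [ceta inc tau]; apply: contrapT => /forallNP unb.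
have {}unb m : y <= iter m eta z by rewrite leNgt; apply/negP.
have le_z m : iter m eta z <= z.
  by apply: iter_eta_le_id; split.
have ctau : {within `[y, z], continuous (fun s => s - eta s)}.
  apply: continuous_subspaceT => s.
  by apply: cvgB; [exact: cvg_id|exact: ceta].
have [c _ cmin] := EVT_min (unb 0%N) ctau.
have /andP[c0 _] := tau c.
have drop m : iter m eta z <= z - m%:R * (c - eta c).
  elim: m => [|m IH]; first by rewrite mul0r subr0.
  have := cmin (iter m eta z); rewrite in_itv /= unb le_z => /(_ isT).
  by move: IH; rewrite -natr1 mulrDl mul1r /=; lra.
have ltm : (z - y) / (c - eta c) < (Num.truncn `|(z - y) / (c - eta c)|).+1%:R.
  by rewrite (le_lt_trans (ler_norm _))// truncnS_gt.
have := drop (Num.truncn `|(z - y) / (c - eta c)|).+1.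
have := unb (Num.truncn `|(z - y) / (c - eta c)|).+1.
by move: ltm; rewrite ltr_pdivrMr//; lra.
Qed.

Lemma eq0_of_le_geometric (R : realType) (a B : R) :
  0 <= a -> (forall n, a <= B * (3 / 4) ^+ n) -> a = 0.
Proof.
move=> a0 aB; apply/eqP; rewrite eq_le a0 andbT.
have q1 : `|3 / 4 : R| < 1 by rewrite ger0_norm; lra.
have cvB : B * (3 / 4) ^+ n @[n --> \oo] --> B * 0.
  by apply: cvgMr; exact: cvg_expr.
rewrite -(mulr0 B); apply: (cvgr_to_ge cvB).
by near=> n; exact: aB.
Unshelve. all: by end_near. Qed.

(** * Sign changes and norm in the phase space *)

(** Adjusting the parity adds at most 1, so [V] can be infinite only if [sc] is. *)
Lemma alternates_unbounded (R : realType) (r : R) (N : nat) (delta a : R)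
    (phi : CK r N) :
  ~ (V delta phi a < +oo)%E ->
  forall k, exists2 k', (k <= k')%N & alternates phi a k'.
Proof.
move=> Voo k; apply: contrapT => noalt; apply: Voo.
have sck : (sc phi a <= k%:R%:E)%E.
  apply: ge_ereal_sup => _ [->|[k' [_ alt] <-]]; rewrite lee_fin ?ler0n//.
  rewrite ler_nat leqNgt; apply/negP => kk'.
  by apply: noalt; exists k' => //; exact: ltnW.
have sc1 : (sc phi a + 1 < +oo)%E.
  by rewrite (@le_lt_trans _ _ (k%:R%:E + 1)%E) ?leeD2r// -EFinD ltry.
have sc0 : (sc phi a < +oo)%E by rewrite (le_lt_trans sck) ?ltry.
by rewrite /V; case: ifP => _; case: ifP.
Qed.

(* The points of [K r N] beyond 0 are the N integers 1, ..., N, so at most the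
   first N points of a decreasing sequence are positive. *)
Lemma alternates_nonpos (R : realType) (r : R) (N : nat) (a : R)
    (phi : CK r N) (n : nat) :
  alternates phi a (N + n) -> exists theta : nat -> K r N,
    [/\ forall i, (i <= n)%N -> a <= set_val (theta i) <= 0,
        forall i, (i < n)%N -> set_val (theta i.+1) < set_val (theta i) &
        forall i, (i < n)%N -> phi (theta i.+1) * phi (theta i) < 0].
Proof.
move=> [theta [thK thd thp]]; exists (fun i => theta (N + i)%N).
(* Each step between positive points lowers the integer by at least 1, whence [j + i <= N]. *)
have pos i : (i <= N + n)%N -> 0 < set_val (theta i) ->
    exists j, [/\ set_val (theta i) = j%:R, (0 < j)%N & (j + i <= N)%N].
  elim: i => [|i IH] iNn th0.
    have [/andP[_]|[j /andP[j0 jN] jE]] := thK _ iNn.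
      by rewrite leNgt th0.
    by exists j; rewrite addn0.
  have ii := thd i iNn.
  have [j [jE j0 jN]] := IH (ltnW iNn) (lt_trans th0 ii).
  have [/andP[_]|[j' /andP[j'0 _] j'E]] := thK _ iNn.
    by rewrite leNgt th0.
  exists j'; split=> //.
  rewrite addnS (leq_trans _ jN)// ltn_add2r.
  by move: ii; rewrite -j'E jE ltr_nat.
split=> i iN.
- have iNn : (N + i <= N + n)%N by rewrite leq_add2l.
  have th0 : set_val (theta (N + i)%N) <= 0.
    rewrite leNgt; apply/negP => /(pos _ iNn)[j [_ j0]].
    rewrite addnCA -{2}(addn0 N) leq_add2l.
    by rewrite leqn0 addn_eq0 -leqn0 leqNgt j0.
  case: (thK _ iNn) => [//|[j /andP[j0 _] jE]].
  by move: th0; rewrite -jE lern0 -leqn0 leqNgt j0.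
- by rewrite addnS thd// -addnS leq_add2l.
- by rewrite addnS thp// -addnS leq_add2l.
Qed.

Lemma segment_norm (R : realType) (r : R) (N : nat) (x : 'I_N.+1 -> R -> R)
    (t : R) (phi : CK r N) :
  0 <= r -> is_segment x t phi -> forall i, `|x i t| <= `|phi|.
Proof.
move=> r0 seg i; have [i0|i0] := posnP i.
  have K0 : K r N (0 : R) by left; rewrite /= lexx oppr_le0 r0.
  have [/(_ (lexx _)) + _] := seg (SigSub (mem_set K0)).
  rewrite /= addr0 (_ : ord0 = i); last exact: val_inj.
  by move=> <-; exact: CK_norm_ub.
have Ki : K r N (i%:R : R).
  by right; exists (i : nat) => //=; rewrite i0 -ltnS ltn_ord.
have [_ /(_ i i0 erefl) <-] := seg (SigSub (mem_set Ki)).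
exact: CK_norm_ub.
Qed.

(** * States with a bounded history *)

(** The solution may change with [s0], so the oscillation is recorded in one function [g] that every
    such solution matches where [g] is nonzero. Thus [z] and [z0] are fixed before [s0], and the
    constant in front of [(3/4)^n] is the same for all [n]. *)
Lemma oscillating_history_eq0 (R : realType) (N : nat) (r delta : R)
    (f : 'I_N.+1 -> R -> R -> R -> R) (eta : R -> R) (M t d z : R)
    (g : R -> R) (phi : CK r N) :
  0 <= r -> delta = 1 \/ delta = -1 -> smooth_rhs f -> feedback_signs f delta ->
  admissible_delay r eta -> linear_bound f -> lipschitz_iterates eta ->
  (forall s0, s0 < t -> exists x : 'I_N.+1 -> R -> R,
    [/\ forall i s, s0 < s ->
          is_derive s 1 (x i) (f i s (x i s) (feedback eta x i s)),
        forall i s, s0 <= s <= t -> `|x i s| <= M &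
        is_segment x t phi]) ->
  d = 1 \/ d = -1 -> oscillates d g z ->
  (forall x, is_segment x t phi -> forall s, g s != 0 -> x ord0 s = g s) ->
  phi = 0.
Proof.
move=> r0 delta1 H1 H2 He H4 [L L0 lipL] hist d1 osc gx.
(* With [z0] below [t - r], the interval [[z0, t]] contains the whole history interval of [phi]. *)
have [m ztr] := iter_eta_unbounded z (t - r) He.
pose z0 := iter m eta z.
have z0t : z0 <= t by rewrite (le_trans (ltW ztr))// gerBl.
have [C C0 fC] : exists2 C : R, 0 < C & forall i s u v,
    `|u| <= M -> `|v| <= M -> `|f i s u v| <= C * (`|u| + `|v|).
  have bB : bounded_set (`[- M, M] `*` `[- M, M] : set (R * R)).
    by apply: compact_bounded; apply: compact_setX; exact: segment_compact.
  have [C C0 fC] := H4 _ bB; exists C => // i s u v uM vM.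
  by apply: (fC i s (u, v)); split; rewrite /= in_itv /= -ler_norml.
have M0 : 0 <= M.
  have t1 : t - 1 < t by rewrite gtrBl.
  have [x [_ xM _]] := hist _ t1.
  by rewrite (le_trans _ (xM ord0 t _))// lexx ltW.
apply/normr0_eq0.
apply: (@eq0_of_le_geometric _ _ (M * expR (8 * L * C * (t - z0)))) => // n.
(* One iterate beyond [n], because [history_oscillates] at [iter n eta z0] needs [s0] below the next
   iterate. *)
pose s0 := iter n.+1 eta z0 - 1.
have s0z k : (k <= n.+1)%N -> s0 < iter k eta z0.
  move=> kn; apply: (@lt_le_trans _ _ (iter n.+1 eta z0)).
    by rewrite gtrBl.
  by rewrite -(subnK kn) iterD (iter_eta_le_id _ _ He).
have s0t : s0 < t by rewrite (lt_le_trans (s0z 0%N isT)).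
have [x [dx xM seg]] := hist s0 s0t.
have oscx k : s0 < iter k eta z -> oscillates d (x ord0) (iter k eta z).
  elim: k => [_ e /osc[[s hs gs] [s' hs' gs']]|k IH s0k].
    by split; [exists s|exists s'] => //; rewrite (gx x seg)//;
      rewrite ?(gt_eqF gs)// (lt_eqF gs').
  have [] // := history_oscillates delta1 H1 H2 He H4 dx d1 s0k (IH _).
  by rewrite (lt_le_trans s0k)// (iter_eta_le_id 1 _ He).
have x0 k i : (k <= n)%N -> x i (iter k eta z0) = 0.
  move=> kn; rewrite /z0 -iterD.
  have s0k : s0 < iter k.+1 eta z0 by exact: s0z.
  rewrite /z0 -iterD in s0k.
  have s0k' : s0 < iter (k + m) eta z.
    by rewrite (lt_le_trans s0k)// (iter_eta_le_id 1 _ He).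
  have [osci _] :=
    history_oscillates delta1 H1 H2 He H4 dx d1 s0k (oscx _ s0k').
  apply: (oscillates_zero d1 _ (osci i)).
  have [dxs _] := dx i _ s0k'.
  by apply: differentiable_continuous; apply/derivable1_diffP.
have decay i s : z0 <= s <= t ->
    `|x i s| <= M * expR (8 * L * C * (t - z0)) * (3 / 4) ^+ n.
  move=> zst; have s0z' k : (k <= n)%N -> s0 < iter k eta z0.
    by move=> kn; apply/s0z/leqW.
  have := history_decay He C0 L0 lipL fC dx xM s0z' x0 (leqnn (0 + n)) i zst.
  move=> /le_trans; apply; rewrite mulrAC.
  apply: ler_wpM2r; first by rewrite exprn_ge0// divr_ge0.
  rewrite ler_wpM2l// ler_expR ler_wpM2l ?lerD2r//; last by case/andP: zst.
  by rewrite !mulr_ge0 ?(ltW L0) ?(ltW C0).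
apply: CK_norm_le => [|p].
  by rewrite !mulr_ge0 ?expR_ge0 ?exprn_ge0 ?divr_ge0.
have [seg0 segi] := seg p.
have [/andP[rp p0]|[j /andP[j0 jN] jp]] := set_valP p.
  rewrite seg0//; apply: decay; rewrite gerDl p0 andbT (le_trans (ltW ztr))//.
  by rewrite lerD2l.
have jN' : (j < N.+1)%N by rewrite ltnS.
by rewrite (segi (Ordinal jN') j0 (esym jp)); apply: decay; rewrite z0t lexx.
Qed.

(** All that is taken from an attractor is a bound [M], independent of [s0], on backward
    continuations; this serves both kinds of attractor. *)
Lemma finite_V_of_bounded_history (R : realType) (N : nat) (r delta : R)
    (f : 'I_N.+1 -> R -> R -> R -> R) (eta : R -> R) (M t : R)
    (phi : CK r N) :
  0 <= r -> delta = 1 \/ delta = -1 -> smooth_rhs f -> feedback_signs f delta ->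
  admissible_delay r eta -> linear_bound f -> lipschitz_iterates eta ->
  (forall s0, s0 < t -> exists x : 'I_N.+1 -> R -> R,
    [/\ forall i s, s0 < s ->
          is_derive s 1 (x i) (f i s (x i s) (feedback eta x i s)),
        forall i s, s0 <= s <= t -> `|x i s| <= M &
        is_segment x t phi]) ->
  phi <> 0 -> (V delta phi (- (t - eta t)) < +oo)%E.
Proof.
move=> r0 delta1 H1 H2 He H4 H5 hist phi0; apply: contrapT => Voo.
apply: phi0.
have [_ _ tau] := He; have /andP[_ taur] := tau t.
have t1 : t - 1 < t by rewrite gtrBl.
have [x [_ _ seg]] := hist _ t1.
(* The default 0 has no sign, so oscillation of [g] only involves points of [[eta t, t]], where
   [phi] determines [x ord0] because [t - eta t <= r]. *)
pose g s := if eta t <= s <= t then x ord0 s else 0.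
have seg_on y s : is_segment y t phi -> eta t <= s <= t ->
    exists2 p : K r N, set_val p = s - t & phi p = y ord0 s.
  move=> segy /andP[etas st].
  have Ks : K r N (s - t) by left; apply/andP; split; lra.
  exists (SigSub (mem_set Ks)) => //.
  have [/(_ _)/[!subr_le0]/(_ st) -> _] := segy (SigSub (mem_set Ks)).
  by rewrite /= addrC subrK.
have gx y : is_segment y t phi -> forall s, g s != 0 -> y ord0 s = g s.
  move=> segy s; rewrite /g; case: ifPn => [st _|]; last by rewrite eqxx.
  have [p pE <-] := seg_on y s segy st; have [p' p'E <-] := seg_on x s seg st.
  by congr (phi _); apply: val_inj; exact: etrans pE (esym p'E).
have [z [d [_ d1 osc]]] : exists z d,
    [/\ eta t <= z <= t, d = 1 \/ d = -1 & oscillates d g z].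
  apply: oscillation_point => n.
  (* The [N] extra sign changes pay for the points [1, ..., N]; a longer alternation is
     truncated. *)
  have [k Nnk [th [thK thd thp]]] := alternates_unbounded Voo (N + n)%N.
  have [|theta [tK td tp]] := @alternates_nonpos R r N (- (t - eta t)) phi n.
    exists th; split=> i ik; [apply: thK|apply: thd|apply: thp];
    exact: leq_trans ik Nnk.
  have gE i : (i <= n)%N -> g (t + set_val (theta i)) = phi (theta i).
    move=> /tK/andP[a0 a1]; rewrite /g ifT; last by apply/andP; split; lra.
    by have [->] := seg (theta i).
  exists (fun i => t + set_val (theta i)); split=> i ik.
  - by have /andP[? ?] := tK i ik; apply/andP; split; lra.
  - by rewrite ltrD2l td.
  - by rewrite !gE ?tp// ltnW.
exact: (oscillating_history_eq0 r0 delta1 H1 H2 He H4 H5 hist d1 osc gx).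
Qed.

Lemma bounded_norm_le (R : realType) (E : normedModType R) (B : set E) :
  bounded_set B -> exists M, forall b, B b -> `|b| <= M.
Proof.
move=> [M [_ BM]]; exists (M + 1) => b Bb.
by apply: (BM (M + 1)) => //; rewrite ltrDl.
Qed.

(** * Bounded histories from the invariance of attractors *)

Theorem theorem3p10 (R : realType) (N : nat) (r : R) (delta : R)
    (f : 'I_N.+1 -> R -> R -> R -> R) (eta : R -> R)
    (r_gt0 : 0 < r) (delta_pm1 : delta = 1 \/ delta = -1)
    (H1 : smooth_rhs f) (H2 : feedback_signs f delta) (H3 : admissible_delay r eta) (H4 : linear_bound f)
    (H5 : lipschitz_iterates eta)
    (Hglob : globally_solvable r f eta)
    (S : R -> R -> CK r N -> CK r N) (HS : generated_process f eta S) :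
  (forall A : R -> set (CK r N),
     global_pullback_attractor S A -> backwards_bounded A ->
     forall (t : R) (phi : CK r N), A t phi -> phi <> 0 ->
       (V delta phi (- (t - eta t)) < +oo)%E) /\
  (forall tau : R, autonomous f eta tau ->
     forall A : set (CK r N),
       global_attractor (fun t => S t 0) A ->
       forall phi : CK r N, A phi -> phi <> 0 ->
         (V delta phi (- tau) < +oo)%E).
Proof.
have r0 := ltW r_gt0; split=> [A [_ Ainv _] bA t phi Aphi phi0|].
  have [M AM] := bounded_norm_le (bA t).
  apply: (finite_V_of_bounded_history (M := M)
    r0 delta_pm1 H1 H2 H3 H4 H5 _ phi0).
  (* Invariance gives an ancestor [psi] of [phi] at time [s0], whose trajectory up to [t] stays in
     the sets [A s], all bounded by [M]. *)
  move=> s0 s0t; have := Aphi.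
  rewrite -(Ainv s0 t (ltW s0t)) => -[psi Apsi Spsi].
  have [x [[_ _ _ dx _] _] seg] := HS s0 psi.
  exists x; split=> [i s s0s|i s /andP[s0s st]|].
  - by apply: dx; rewrite ?ltry.
  - apply: le_trans (segment_norm r0 (seg s s0s) i) _.
    by apply: AM; exists s => //=; rewrite -(Ainv s0 s s0s); exists psi.
  - by rewrite -Spsi; apply: seg; exact: ltW.
move=> tau [faut etatau] A [cA Ainv _] phi Aphi phi0.
have [M AM] := bounded_norm_le (compact_bounded cA).
(* The autonomous case is read at time 0. *)
rewrite -(etatau 0).
apply: (finite_V_of_bounded_history (M := M)
  r0 delta_pm1 H1 H2 H3 H4 H5 _ phi0).
move=> s0 s00; have T0 : 0 <= - s0 by rewrite oppr_ge0 ltW.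
have := Aphi; rewrite -(Ainv _ T0) => -[psi Apsi Spsi].
have [x [[_ _ _ dx _] _] seg] := HS 0 psi.
(* The semiflow starts at time 0, so the solution from [psi] is shifted from [[0, -s0]] to
   [[s0, 0]]; it remains a solution because [f] is independent of time and the delay is constant. *)
exists (fun i s => x i (s - s0)); split=> [i s s0s|i s /andP[s0s _]|].
- have fbE : feedback eta (fun i s => x i (s - s0)) i s =
      feedback eta x i (s - s0).
    rewrite /feedback; case: ifP => // _; congr (x _ _).
    by have := etatau s; have := etatau (s - s0); lra.
  rewrite fbE (faut i s (s - s0)).
  have d1 : is_derive s 1 (fun s => s - s0) 1.
    rewrite -[X in is_derive _ _ _ X]subr0.
    exact: (is_deriveB (is_derive_id s 1) (is_derive_cst s0 s 1)).
  rewrite -[X in is_derive _ _ _ X]mulr1.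
  have ss0 : 0 < s - s0 by rewrite subr_gt0.
  exact: (@is_derive1_comp _ (x i) (fun s => s - s0) _ _ _
    (dx i (s - s0) ss0 (ltry _)) d1).
- have ss0 : 0 <= s - s0 by rewrite subr_ge0.
  apply: le_trans (segment_norm r0 (seg _ ss0) i) _.
  by apply: AM; rewrite -(Ainv _ ss0); exists psi.
- move=> p; have := seg _ T0; rewrite Spsi => /(_ p)[segp0 segpi]; split.
    by move=> /segp0 ->; congr (x _ _); rewrite add0r addrC.
  by move=> i i0 /(segpi i i0) ->; rewrite sub0r.
Qed.
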